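(* The class of van Rees quasigroups [respectively, van Rees loops] $(Q,\cdot,\backslash,/)$ forms a variety of quasigroups [respectively, loops], defined, within the variety of all quasigroups [respectively, loops], by the identities $$x\cdot\bigl(y\backslash (x\cdot z)\bigr) = y\cdot\bigl(x\backslash (y\cdot z)\bigr),$$ $$\bigl((x\cdot y)/ z\bigr)\cdot y = \bigl((x\cdot z)/ y\bigr)\cdot z .$$ That is, a quasigroup [loop] is a van Rees quasigroup [loop] if and only if it satisfies these two identities.
   Context: A quasigroup $(Q;\cdot,\backslash,/)$ is a set with three binary operations satisfying $x\backslash (xy)=x(x\backslash y)=y$ and $(xy)/y=(x/y)y=x$; a loop is a quasigroup with a two-sided neutral element $\varepsilon$. Quasigroups $(Q,\cdot)$ and $(P,\circ)$ are isotopic if there are bijections $\alpha,\beta,\gamma:Q\to P$ with $\alpha(x)\circ\beta(y)=\gamma(x\cdot y)$ for all $x,y$. A loop has exponent $3$ if it satisfies $xx\cdot x=x\cdot xx=\varepsilon$ for all $x$. A van Rees quasigroup [loop] is a quasigroup [loop] $Q$ such that every loop isotopic to $Q$ has exponent $3$. *)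

(* Defs.v *)
From mathcomp Require Import all_boot.

Set Implicit Arguments.
Unset Strict Implicit.
Unset Printing Implicit Defensive.

(* The carrier may be empty: a quasigroup is a model of four identities without
   constants. *)
Record quasigroup : Type := Quasigroup {
  qg_carrier :> Type;
  qg_mul : qg_carrier -> qg_carrier -> qg_carrier;
  qg_ldiv : qg_carrier -> qg_carrier -> qg_carrier;
  qg_rdiv : qg_carrier -> qg_carrier -> qg_carrier;
  qg_mulKl : forall x y, qg_ldiv x (qg_mul x y) = y;
  qg_ldivK : forall x y, qg_mul x (qg_ldiv x y) = y;
  qg_mulKr : forall x y, qg_rdiv (qg_mul x y) y = x;
  qg_rdivK : forall x y, qg_mul (qg_rdiv x y) y = x
}.

Declare Scope quasigroup_scope.
Delimit Scope quasigroup_scope with QG.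
Notation "x * y" := (qg_mul x y) : quasigroup_scope.
Notation "x \ y" := (qg_ldiv x y)
  (at level 40, left associativity) : quasigroup_scope.
Notation "x / y" := (qg_rdiv x y) : quasigroup_scope.

Local Open Scope quasigroup_scope.

Record loop : Type := Loop {
  loop_quasigroup :> quasigroup;
  loop_one : loop_quasigroup;
  loop_mul1x : forall x : loop_quasigroup, loop_one * x = x;
  loop_mulx1 : forall x : loop_quasigroup, x * loop_one = x
}.

Definition isotopic (Q P : quasigroup) : Prop :=
  exists alpha beta gamma : Q -> P,
    [/\ bijective alpha, bijective beta, bijective gamma
      & forall x y : Q, alpha x * beta y = gamma (x * y)].

Definition exponent3 (L : loop) : Prop :=
  forall x : L, (x * x) * x = loop_one L /\ x * (x * x) = loop_one L.

(* Loops isotopic to Q have carriers equinumerous with that of Q, so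
   quantifying over loops in the universe of Q loses nothing. *)
Definition van_rees_quasigroup (Q : quasigroup) : Prop :=
  forall L : loop, isotopic L Q -> exponent3 L.

Definition van_rees_loop (L : loop) : Prop := van_rees_quasigroup L.

(* Terms over the quasigroup operations, variables indexed by nat, with
   constant symbols in C: C = void gives quasigroup terms and C = unit gives
   loop terms, whose only constant symbol is the neutral element. *)
Inductive term (C : Type) : Type :=
| Var of nat
| Cst of C
| Mul of term C & term C
| Ldiv of term C & term C
| Rdiv of term C & term C.

Fixpoint eval (C : Type) (Q : quasigroup) (cst : C -> Q) (v : nat -> Q)
    (t : term C) : Q :=
  match t with
  | Var n => v n
  | Cst c => cst c
  | Mul s t => eval cst v s * eval cst v t
  | Ldiv s t => eval cst v s \ eval cst v t
  | Rdiv s t => eval cst v s / eval cst v t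
  end.

Definition identity (C : Type) : Type := (term C * term C)%type.

Definition satisfies (C : Type) (Q : quasigroup) (cst : C -> Q)
    (i : identity C) : Prop :=
  forall v : nat -> Q, eval cst v i.1 = eval cst v i.2.

Definition quasigroup_satisfies (Q : quasigroup) (i : identity void) : Prop :=
  satisfies (of_void Q) i.

Definition loop_satisfies (L : loop) (i : identity unit) : Prop :=
  satisfies (fun _ : unit => loop_one L) i.

Definition quasigroup_variety (K : quasigroup -> Prop) : Prop :=
  exists E : identity void -> Prop,
    forall Q : quasigroup, K Q <-> (forall i, E i -> quasigroup_satisfies Q i).

Definition loop_variety (K : loop -> Prop) : Prop :=
  exists E : identity unit -> Prop,
    forall L : loop, K L <-> (forall i, E i -> loop_satisfies L i).

(* Main.v *)
(** The loops isotopic to [Q] are, up to isomorphism, its principal isotopes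
    [x o y = (x / b) * (a \ y)], with neutral element [a * b].  Writing
    [x = u * b] turns [x o (x o x) = a * b] into
    [u * (a \ (u * (a \ (u * b)))) = a * b], and the substitution
    [u * b = a * z] turns this into the first identity.  The second identity
    is the mirror image, obtained from [(x o x) o x = a * b] with
    [x = a * v]. *)
Require Import Defs.
From mathcomp Require Import all_boot.

Local Open Scope quasigroup_scope.

Section PrincipalIsotope.
Variables (Q : quasigroup) (a b : Q).

Definition isotope_mul (x y : Q) : Q := (x / b) * (a \ y).
Definition isotope_ldiv (x y : Q) : Q := a * ((x / b) \ y).
Definition isotope_rdiv (x y : Q) : Q := (x / (a \ y)) * b.

Lemma isotope_mulKl x y : isotope_ldiv x (isotope_mul x y) = y.
Proof. by rewrite /isotope_ldiv /isotope_mul qg_mulKl qg_ldivK. Qed.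

Lemma isotope_ldivK x y : isotope_mul x (isotope_ldiv x y) = y.
Proof. by rewrite /isotope_ldiv /isotope_mul qg_mulKl qg_ldivK. Qed.

Lemma isotope_mulKr x y : isotope_rdiv (isotope_mul x y) y = x.
Proof. by rewrite /isotope_rdiv /isotope_mul qg_mulKr qg_rdivK. Qed.

Lemma isotope_rdivK x y : isotope_mul (isotope_rdiv x y) y = x.
Proof. by rewrite /isotope_rdiv /isotope_mul qg_mulKr qg_rdivK. Qed.

Definition isotope_quasigroup : quasigroup :=
  Quasigroup isotope_mulKl isotope_ldivK isotope_mulKr isotope_rdivK.

Lemma isotope_mul1x (x : isotope_quasigroup) :
  (a * b : isotope_quasigroup) * x = x.
Proof. by rewrite /= /isotope_mul qg_mulKr qg_ldivK. Qed.

Lemma isotope_mulx1 (x : isotope_quasigroup) :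
  x * (a * b : isotope_quasigroup) = x.
Proof. by rewrite /= /isotope_mul qg_mulKl qg_rdivK. Qed.

Definition principal_isotope : loop :=
  @Loop isotope_quasigroup (a * b) isotope_mul1x isotope_mulx1.

Lemma isotopic_principal_isotope : isotopic principal_isotope Q.
Proof.
exists (fun x : Q => x / b), (fun x : Q => a \ x), id; split=> //=.
- by exists (fun x : Q => x * b) => x; rewrite ?qg_rdivK ?qg_mulKr.
- by exists (fun x : Q => a * x) => x; rewrite ?qg_ldivK ?qg_mulKl.
- by exists id.
Qed.

End PrincipalIsotope.

(** Take [a] and [b] to be the images of the neutral element under [alpha] and [beta]. Setting one
    argument of the isotopy equation to the neutral element gives [gamma x = alpha x * b] and
    [gamma y = a * beta y], which determine [alpha] and [beta] from [gamma]. *)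
Lemma isotopic_loop_principal (L : loop) (Q : quasigroup) : isotopic L Q ->
  exists (a b : Q) (gamma : L -> Q),
    [/\ injective gamma, gamma (loop_one L) = a * b
      & forall x y, gamma (x * y) = isotope_mul Q a b (gamma x) (gamma y)].
Proof.
move=> [alpha [beta [gamma [_ _ /bij_inj gamma_inj alphabeta]]]].
exists (alpha (loop_one L)), (beta (loop_one L)), gamma; split=> // [|x y].
  by rewrite alphabeta loop_mul1x.
have gammal : gamma x = alpha x * beta (loop_one L).
  by rewrite alphabeta loop_mulx1.
have gammar : gamma y = alpha (loop_one L) * beta y.
  by rewrite alphabeta loop_mul1x.
by rewrite /isotope_mul gammal gammar qg_mulKr qg_mulKl alphabeta.
Qed.

Lemma van_rees_principalP (Q : quasigroup) :
  van_rees_quasigroup Q <-> forall a b : Q, exponent3 (principal_isotope Q a b).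
Proof.
split=> [vrQ a b | exp3 L]; first exact/vrQ/isotopic_principal_isotope.
move=> /isotopic_loop_principal[a [b [gamma [gamma_inj gamma1 gammaM]]]] x.
have [/= exl exr] := exp3 a b (gamma x).
(* Exponent 3 is pulled back to [L] along the injective homomorphism [gamma]. *)
by split; apply: gamma_inj; rewrite !gammaM gamma1.
Qed.

Definition van_rees_identities (Q : quasigroup) : Prop :=
  (forall x y z : Q, x * (y \ (x * z)) = y * (x \ (y * z))) /\
  (forall x y z : Q, ((x * y) / z) * y = ((x * z) / y) * z).

Lemma van_rees_identitiesP (Q : quasigroup) :
  van_rees_quasigroup Q <-> van_rees_identities Q.
Proof.
split=> [/van_rees_principalP exp3 | [idl idr]].
  split=> x y z.
    have ub : (y * z) / (x \ (y * z)) = x.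
      by rewrite -{1}[y * z](qg_ldivK x) qg_mulKr.
    (* With [a = y] and [b = x \ (y * z)], the element [y * z] is both [a * z] and [x * b], so its
       cube is [x * (y \ (x * z))], and [a * b] is the right-hand side. *)
    have [_] := exp3 y (x \ (y * z)) (y * z).
    by rewrite /= /isotope_mul qg_mulKl ub.
  have av : ((x * z) / y) \ (x * z) = y.
    by rewrite -{2}[x * z](qg_rdivK _ y) qg_mulKl.
  have [+ _] := exp3 ((x * z) / y) z (x * z).
  by rewrite /= /isotope_mul qg_mulKr av.
apply/van_rees_principalP => a b x; rewrite /= /isotope_mul; split.
  (* The second identity at [x / b], [a \ x], [b] reduces the cube to [(x / (a \ x)) * b], and
     [x / (a \ x) = a]. *)
  by rewrite idr qg_rdivK -{1}[x](qg_ldivK a) qg_mulKr.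
by rewrite idl qg_ldivK -{2}[x](qg_rdivK _ b) qg_mulKl.
Qed.

Definition van_rees_identityl (C : Type) : identity C :=
  let x := Var C 0 in let y := Var C 1 in let z := Var C 2 in
  (Mul x (Ldiv y (Mul x z)), Mul y (Ldiv x (Mul y z))).

Definition van_rees_identityr (C : Type) : identity C :=
  let x := Var C 0 in let y := Var C 1 in let z := Var C 2 in
  (Mul (Rdiv (Mul x y) z) y, Mul (Rdiv (Mul x z) y) z).

Definition van_rees_axioms (C : Type) (i : identity C) : Prop :=
  i = van_rees_identityl C \/ i = van_rees_identityr C.

(** Neither identity contains a constant symbol, so a single argument covers the quasigroup and loop
    signatures, whatever [cst] is. *)
Lemma van_rees_axiomsP (C : Type) (Q : quasigroup) (cst : C -> Q) :
  van_rees_quasigroup Q <->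
  (forall i, van_rees_axioms C i -> satisfies cst i).
Proof.
split=> [/van_rees_identitiesP[idl idr] i [] -> v | sat].
- exact: idl.
- exact: idr.
apply/van_rees_identitiesP; split=> x y z.
  (* Variables 0 and 1 receive [x] and [y]; variable 2 falls past the end of the list and receives
     the default [z]. *)
  exact: (sat _ (or_introl erefl) (fun n => nth z [:: x; y] n)).
exact: (sat _ (or_intror erefl) (fun n => nth z [:: x; y] n)).
Qed.

Theorem theorem2 :
  [/\ quasigroup_variety van_rees_quasigroup,
      loop_variety van_rees_loop,
      (forall Q : quasigroup,
         van_rees_quasigroup Q <->
         (forall x y z : Q, x * (y \ (x * z)) = y * (x \ (y * z))) /\
         (forall x y z : Q, ((x * y) / z) * y = ((x * z) / y) * z))
    & (forall L : loop,
         van_rees_loop L <->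
         (forall x y z : L, x * (y \ (x * z)) = y * (x \ (y * z))) /\
         (forall x y z : L, ((x * y) / z) * y = ((x * z) / y) * z))].
Proof.
split.
- by exists (van_rees_axioms void) => Q; apply: van_rees_axiomsP.
- by exists (van_rees_axioms unit) => L; apply: van_rees_axiomsP.
- exact: van_rees_identitiesP.
- by move=> L; apply: van_rees_identitiesP.
Qed.
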